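(* In $\Sigma_3$ put $$s_1=x_{(1,2)}^2,\quad s_2=x_{(2,3)}^2,\quad s_3=x_{(1,3)}^2,\quad s_4=x_{(1,2,3)}\cdot x_{(1,3,2)},$$ $$s_5=x_{(1,2,3)}\cdot x_{(1,2)}\cdot x_{(2,3)},\quad s_6=x_{(1,2,3)}^3,\quad s_7=x_{(1,3,2)}^3 .$$ All of these belong to $\Sigma_{3,\mathbf 1}=\{s\in\Sigma_3\mid\alpha(s)=\mathbf 1\}$, and each element $s\in\Sigma_{3,\mathbf 1}$, $s\ne\mathbf 1$, has a normal form, that is, it is equal to one and only one of the following expressions: (1) $s_i^n$ with $i\in\{1,2,3\}$, $n\geq 1$; (2) $s_4^a\cdot s_6^m\cdot s_7^n$ with $0\le a\le 2$, $m\ge0$, $n\ge0$, $a+m+n>0$; (3) $s_1^n\cdot s_2$ with $n\geq1$; (4) $s_1^n\cdot s_6^m$ with $m,n\ge1$; (5) $s_1^n\cdot s_5\cdot s_6^m$ with $m\ge0$, $n\ge0$; (6) $s_1^n\cdot s_4\cdot s_6^m$ with $m\ge0$, $n\ge1$.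
   Context: $\mathcal S_3$ is the symmetric group on $\{1,2,3\}$; permutations act on the right (products are read from left to right), and $(i_1,\dots,i_k)$ sends $i_1\mapsto i_2\mapsto\dots\mapsto i_k\mapsto i_1$. $\Sigma_3$ is the semigroup with unit $\mathbf 1$ generated by letters $x_\sigma$, $\sigma\in\mathcal S_3$, subject to $x_{\sigma_1}\cdot x_{\sigma_2}=x_{\sigma_2}\cdot x_{\sigma_2^{-1}\sigma_1\sigma_2}$ and $x_{\sigma_1}\cdot x_{\sigma_2}=x_{\sigma_1\sigma_2\sigma_1^{-1}}\cdot x_{\sigma_1}$, with $x_{\mathbf 1}$ equal to the unit. $\alpha:\Sigma_3\to\mathcal S_3$ is the homomorphism $x_\sigma\mapsto\sigma$. *)

(* Defs.v *)
From HB Require Import structures.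
From mathcomp Require Import all_boot all_fingroup.
From mathcomp Require Import generic_quotient boolp.

Set Implicit Arguments.
Unset Strict Implicit.
Unset Printing Implicit Defensive.

Local Open Scope group_scope.
Local Open Scope quotient_scope.

(* The cycle (i_1, ..., i_k).  Products in {perm T} are read from left to
   right: (s * t) x = t (s x). *)
Definition cyc (T : finType) (c : seq T) (Uc : uniq c) : {perm T} :=
  perm (can_inj (prev_next Uc)).

Definition pt1 : 'I_3 := @Ordinal 3 0 isT.
Definition pt2 : 'I_3 := @Ordinal 3 1 isT.
Definition pt3 : 'I_3 := @Ordinal 3 2 isT.

Definition c12 : 'S_3 := @cyc 'I_3 [:: pt1; pt2] isT.
Definition c23 : 'S_3 := @cyc 'I_3 [:: pt2; pt3] isT.
Definition c13 : 'S_3 := @cyc 'I_3 [:: pt1; pt3] isT.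
Definition c123 : 'S_3 := @cyc 'I_3 [:: pt1; pt2; pt3] isT.
Definition c132 : 'S_3 := @cyc 'I_3 [:: pt1; pt3; pt2] isT.

(* Words in the letters x_sigma are sequences of permutations; this is the
   congruence generated by the defining relations of Sigma_3. *)
Inductive wcong : seq 'S_3 -> seq 'S_3 -> Prop :=
| wcong_refl u : wcong u u
| wcong_sym u v : wcong u v -> wcong v u
| wcong_trans u v w : wcong u v -> wcong v w -> wcong u w
| wcong_cat u u' v v' : wcong u u' -> wcong v v' -> wcong (u ++ v) (u' ++ v')
| wcong_right (a b : 'S_3) : wcong [:: a; b] [:: b; b^-1 * a * b]
| wcong_left (a b : 'S_3) : wcong [:: a; b] [:: a * b * a^-1; a]
| wcong_unit : wcong [:: 1] [::].

Definition wcongb : rel (seq 'S_3) := fun u v => `[< wcong u v >].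

Fact wcongb_refl : reflexive wcongb.
Proof. by move=> u; apply/asboolP/wcong_refl. Qed.

Fact wcongb_sym : symmetric wcongb.
Proof. by move=> u v; apply/asboolP/asboolP; apply: wcong_sym. Qed.

Fact wcongb_trans : transitive wcongb.
Proof.
move=> v u w /asboolP uv /asboolP vw.
by apply/asboolP; apply: wcong_trans uv vw.
Qed.

Canonical wcong_equiv := EquivRel wcongb wcongb_refl wcongb_sym wcongb_trans.

Definition Sigma3 := {eq_quot wcong_equiv}.

HB.instance Definition _ := Choice.on Sigma3.
HB.instance Definition _ := EqQuotient.on Sigma3.

Lemma pi_wcong u v : \pi_Sigma3 u = \pi_Sigma3 v <-> wcong u v.
Proof. by split=> [/eqmodP/asboolP|uv]; last exact/eqmodP/asboolP. Qed.

Lemma repr_wcong u : wcong (repr (\pi_Sigma3 u)) u.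
Proof. by apply/pi_wcong; rewrite reprK. Qed.

Definition Sigma3_mul (s t : Sigma3) : Sigma3 := \pi_Sigma3 (repr s ++ repr t).
Definition Sigma3_one : Sigma3 := \pi_Sigma3 [::].

Lemma Sigma3_mul_pi u v :
  Sigma3_mul (\pi_Sigma3 u) (\pi_Sigma3 v) = \pi_Sigma3 (u ++ v).
Proof. by apply/pi_wcong/wcong_cat; apply: repr_wcong. Qed.

Fact Sigma3_mulA : associative Sigma3_mul.
Proof.
move=> s t r; apply/pi_wcong.
apply: (@wcong_trans _ (repr s ++ repr t ++ repr r)).
  exact: wcong_cat (wcong_refl _) (repr_wcong _).
rewrite catA.
exact: wcong_cat (wcong_sym (repr_wcong _)) (wcong_refl _).
Qed.

Fact Sigma3_mul1s : left_id Sigma3_one Sigma3_mul.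
Proof. by move=> s; rewrite -[s]reprK Sigma3_mul_pi. Qed.

Fact Sigma3_muls1 : right_id Sigma3_one Sigma3_mul.
Proof. by move=> s; rewrite -[s]reprK Sigma3_mul_pi cats0. Qed.

HB.instance Definition _ :=
  isMonoid.Build Sigma3 Sigma3_mulA Sigma3_mul1s Sigma3_muls1.

Definition x_ (a : 'S_3) : Sigma3 := \pi_Sigma3 [:: a].

Lemma x_right a b : x_ a * x_ b = x_ b * x_ (b^-1 * a * b).
Proof.
rewrite /x_ [LHS]Sigma3_mul_pi [RHS]Sigma3_mul_pi.
by apply/pi_wcong; apply: wcong_right.
Qed.

Lemma x_left a b : x_ a * x_ b = x_ (a * b * a^-1) * x_ a.
Proof.
rewrite /x_ [LHS]Sigma3_mul_pi [RHS]Sigma3_mul_pi.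
by apply/pi_wcong; apply: wcong_left.
Qed.

Lemma x_unit : x_ 1 = 1.
Proof. by apply/pi_wcong; apply: wcong_unit. Qed.

Definition alpha (s : Sigma3) : 'S_3 := \prod_(a <- repr s) a.

Lemma wcong_prod u v : wcong u v -> \prod_(a <- u) a = \prod_(a <- v) a.
Proof.
elim=> {u v} //.
- by move=> u v w _ -> _ ->.
- by move=> u u' v v' _ uu' _ vv'; rewrite !big_cat uu' vv'.
- by move=> a b; rewrite !big_cons big_nil !mulg1 !mulgA mulgV mul1g.
- by move=> a b; rewrite !big_cons big_nil !mulg1 mulgKV.
- by rewrite big_seq1 big_nil.
Qed.

Lemma alpha_pi u : alpha (\pi_Sigma3 u) = \prod_(a <- u) a.
Proof. exact/wcong_prod/repr_wcong. Qed.

Lemma alpha_x a : alpha (x_ a) = a.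
Proof. by rewrite alpha_pi big_seq1. Qed.

Fact alpha_morphism : monoid_morphism alpha.
Proof.
split; first by rewrite [LHS]alpha_pi big_nil.
move=> s t; rewrite -[s]reprK -[t]reprK.
by rewrite [_ * _]Sigma3_mul_pi !alpha_pi big_cat.
Qed.

HB.instance Definition _ :=
  isUMagmaMorphism.Build Sigma3 'S_3 alpha alpha_morphism.

Definition Sigma31 : {pred Sigma3} := [pred s | alpha s == 1].

Definition s1 : Sigma3 := x_ c12 ^+ 2.
Definition s2 : Sigma3 := x_ c23 ^+ 2.
Definition s3 : Sigma3 := x_ c13 ^+ 2.
Definition s4 : Sigma3 := x_ c123 * x_ c132.
Definition s5 : Sigma3 := x_ c123 * x_ c12 * x_ c23.
Definition s6 : Sigma3 := x_ c123 ^+ 3.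
Definition s7 : Sigma3 := x_ c132 ^+ 3.

(* Formal expressions, so that two normal forms with different shapes or
   different parameters are different expressions. *)
Inductive nf_expr : Type :=
| NF1 (i : 'I_3) (n : nat)
| NF2 (a m n : nat)
| NF3 (n : nat)
| NF4 (n m : nat)
| NF5 (n m : nat)
| NF6 (n m : nat).

Definition nf_range (e : nf_expr) : bool :=
  match e with
  | NF1 _ n => 1 <= n
  | NF2 a m n => (a <= 2) && (0 < a + m + n)
  | NF3 n => 1 <= n
  | NF4 n m => (1 <= m) && (1 <= n)
  | NF5 _ _ => true
  | NF6 n _ => 1 <= n
  end%N.

(* The index i : 'I_3 of NF1 is 0-based: i = 0, 1, 2 stands for s1, s2, s3. *)
Definition nf_val (e : nf_expr) : Sigma3 :=
  match e with
  | NF1 i n => tnth [tuple s1; s2; s3] i ^+ n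
  | NF2 a m n => s4 ^+ a * s6 ^+ m * s7 ^+ n
  | NF3 n => s1 ^+ n * s2
  | NF4 n m => s1 ^+ n * s6 ^+ m
  | NF5 n m => s1 ^+ n * s5 * s6 ^+ m
  | NF6 n m => s1 ^+ n * s4 * s6 ^+ m
  end.

(* Main.v *)
(* Write A, B, C, R, Q for the letters of (1,2), (2,3), (1,3), (1,2,3), (1,3,2).
   All defining relations read XY = YZ with xy = yz in S_3.  Hence a
   transposition turns an adjacent R into a Q and back, so once a word contains
   a transposition all its 3-cycles can be made equal to R and moved to the
   right; moreover B^2 R = C^2 R = A^2 R, and A C^2 = A B^2, A B^3 = A^3 B.
   Therefore every element of Sigma_3 is one of R^i Q^j, T^n,
   A^n B, A^n C, A^n B^2 (n >= 1) or A^n T R^l (l >= 1) with T in {A, B, C}: this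
   list is stable under right multiplication by each letter.  Imposing
   alpha = 1 leaves the six families of the theorem.

   Uniqueness comes from invariants of words: the number of odd letters, the
   number of 3-cycles, whether all letters lie in a given subgroup and, if that
   subgroup is abelian, the number of occurrences of each nontrivial letter. *)
Require Import Defs.
From mathcomp Require Import all_boot all_fingroup.
From mathcomp Require Import cyclic generic_quotient zify.

Set Implicit Arguments.
Unset Strict Implicit.
Unset Printing Implicit Defensive.

Local Open Scope group_scope.
Local Open Scope quotient_scope.

(** * The six permutations of three points *)

Lemma cycE (T : finType) (c : seq T) (Uc : uniq c) x : cyc Uc x = next c x.
Proof. exact: permE. Qed.

Lemma ord3P (P : 'I_3 -> Prop) : P pt1 -> P pt2 -> P pt3 -> forall i, P i.
Proof.
move=> P1 P2 P3 [[|[|[|//]]] lti3].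
- by rewrite (_ : Ordinal _ = pt1) //; apply: val_inj.
- by rewrite (_ : Ordinal _ = pt2) //; apply: val_inj.
- by rewrite (_ : Ordinal _ = pt3) //; apply: val_inj.
Qed.

Ltac perm3 := apply/permP; apply: ord3P; by rewrite ?permM ?perm1 !cycE.
Ltac perm3_neq :=
  let E := fresh in move=> /permP E; move: (E pt1) (E pt2) (E pt3);
  by rewrite ?permM ?perm1 ?cycE.

Lemma S3_ind (P : 'S_3 -> Prop) :
  P 1 -> P c12 -> P c23 -> P c13 -> P c123 -> P c132 -> forall g, P g.
Proof.
move=> P1 Pa Pb Pc Pr Pq g.
have gE (h : 'S_3) : h pt1 = g pt1 -> h pt2 = g pt2 -> h pt3 = g pt3 -> P h -> P g.
  by move=> h1 h2 h3; rewrite (_ : g = h) //; apply/permP; apply: ord3P.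
have n12 : g pt1 != g pt2 by rewrite (inj_eq perm_inj).
have n13 : g pt1 != g pt3 by rewrite (inj_eq perm_inj).
have n23 : g pt2 != g pt3 by rewrite (inj_eq perm_inj).
move: (g pt1) (g pt2) (g pt3) n12 n13 n23 gE.
do 3 apply: ord3P => //; move=> _ _ _ gE.
- by apply: gE P1; rewrite perm1.
- by apply: gE Pb; rewrite cycE.
- by apply: gE Pa; rewrite cycE.
- by apply: gE Pr; rewrite cycE.
- by apply: gE Pq; rewrite cycE.
- by apply: gE Pc; rewrite cycE.
Qed.

(** The equation forces [c] to be [b^-1 * a * b], so no conjugate has to be computed; the other
    defining relation is this one read from right to left. *)
Lemma x_swap (a b c : 'S_3) : a * b = b * c -> x_ a * x_ b = x_ b * x_ c.
Proof. by move=> abc; rewrite x_right -mulgA abc mulKg. Qed.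

(** * Exchange rules for the five nontrivial letters *)

Local Notation A := (x_ c12).
Local Notation B := (x_ c23).
Local Notation C := (x_ c13).
Local Notation R := (x_ c123).
Local Notation Q := (x_ c132).

Ltac xswap := apply: x_swap; perm3.

(** Products of two distinct transposition letters fall into two classes, according to their image
    in ['S_3]; the first four rules make each of them begin with [A]. *)
Lemma xBC : B * C = A * B.
Proof. by transitivity (C * A); xswap. Qed.
Lemma xCA : C * A = A * B. Proof. xswap. Qed.
Lemma xBA : B * A = A * C. Proof. xswap. Qed.
Lemma xCB : C * B = A * C.
Proof. by transitivity (B * A); xswap. Qed.
Lemma xRA : R * A = C * R. Proof. symmetry; xswap. Qed.
Lemma xRB : R * B = A * R. Proof. symmetry; xswap. Qed.
Lemma xRC : R * C = B * R. Proof. symmetry; xswap. Qed.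
Lemma xQA : Q * A = A * R. Proof. xswap. Qed.
Lemma xQB : Q * B = B * R. Proof. xswap. Qed.
Lemma xQC : Q * C = C * R. Proof. xswap. Qed.
Lemma xAQ : A * Q = C * R.
Proof. by rewrite -xQC; xswap. Qed.
Lemma xBQ : B * Q = A * R.
Proof. by rewrite -xQA; xswap. Qed.
Lemma xCQ : C * Q = B * R.
Proof. by rewrite -xQB; xswap. Qed.
Lemma xQR : Q * R = R * Q. Proof. xswap. Qed.

(** Since [A B = C A = B C] and [C B = A C], one has [A B B = C A B = C B C = A C C]. *)
Lemma xACC : A * C * C = A * B * B.
Proof. by rewrite -xCA -[in RHS]mulgA -xBC !mulgA xCB. Qed.

Lemma xABBB : A * B * B * B = A * A * A * B.
Proof. by rewrite -xACC -!mulgA xCB [C * (_ * _)]mulgA xCA -mulgA xBC !mulgA. Qed.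

(** [B] is carried around the 3-cycle: [B B R = B Q B = A R B = A A R]. *)
Lemma xBBR : B * B * R = A * A * R.
Proof.
by rewrite -mulgA -xQB mulgA xBQ -mulgA xRB mulgA.
Qed.

Lemma xCCR : C * C * R = A * A * R.
Proof.
by rewrite -mulgA -xRA mulgA -xQC -mulgA xCA mulgA xQA -mulgA xRB mulgA.
Qed.

Lemma xBBA : B * B * A = A * B * B.
Proof. by rewrite -mulgA xBA mulgA xBA xACC. Qed.

Lemma xBBC : B * B * C = A * A * C.
Proof. by rewrite -mulgA xBC mulgA xBA -mulgA xCB mulgA. Qed.

Variant is_tr : Sigma3 -> Prop :=
| TrA : is_tr A
| TrB : is_tr B
| TrC : is_tr C.

Lemma trQ T : is_tr T -> exists2 U, is_tr U & T * Q = U * R.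
Proof.
case.
- by exists C; [exact: TrC | rewrite xAQ].
- by exists A; [exact: TrA | rewrite xBQ].
- by exists B; [exact: TrB | rewrite xCQ].
Qed.

Lemma Rtr T : is_tr T -> exists2 U, is_tr U & R * T = U * R.
Proof.
case.
- by exists C; [exact: TrC | rewrite xRA].
- by exists A; [exact: TrA | rewrite xRB].
- by exists B; [exact: TrB | rewrite xRC].
Qed.

Lemma trR T : is_tr T -> exists2 U, is_tr U & T * R = R * U.
Proof.
case.
- by exists B; [exact: TrB | rewrite xRB].
- by exists C; [exact: TrC | rewrite xRC].
- by exists A; [exact: TrA | rewrite xRA].
Qed.

Lemma Qtr T : is_tr T -> Q * T = T * R.
Proof. by case; rewrite (xQA, xQB, xQC). Qed.

Lemma RXtr T l : is_tr T -> exists2 U, is_tr U & R ^+ l * T = U * R ^+ l.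
Proof.
move=> trT; elim: l => [|l [U trU RU]]; first by exists T; rewrite ?mul1g ?mulg1.
have [V trV RV] := Rtr trU.
by exists V => //; rewrite expgS -mulgA RU mulgA RV mulgA.
Qed.

Lemma RXQC l : R ^+ l * Q = Q * R ^+ l.
Proof. by apply/commute_sym/commuteX/xQR. Qed.

(** Distinct letters can be made to begin with [A] anyway. The factor [R] is what lets the squares
    [B B] and [C C] do so too, by [xBBR] and [xCCR]. *)
Lemma tr2R T U : is_tr T -> is_tr U ->
  exists2 V, is_tr V & T * U * R = A * V * R.
Proof.
case; case.
- by exists A => //; exact: TrA.
- by exists B => //; exact: TrB.
- by exists C => //; exact: TrC.
- by exists C; rewrite ?xBA //; exact: TrC.
- by exists A; rewrite ?xBBR //; exact: TrA.
- by exists B; rewrite ?xBC //; exact: TrB.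
- by exists B; rewrite ?xCA //; exact: TrB.
- by exists C; rewrite ?xCB //; exact: TrC.
- by exists A; rewrite ?xCCR //; exact: TrA.
Qed.

Lemma tr_swap T U : is_tr T -> is_tr U -> exists2 V, is_tr V & T * U = U * V.
Proof.
case; case.
- by exists A => //; exact: TrA.
- by exists C; rewrite ?xBC //; exact: TrC.
- by exists B; rewrite ?xCB //; exact: TrB.
- by exists C; rewrite ?xBA //; exact: TrC.
- by exists B => //; exact: TrB.
- by exists A; rewrite ?xBC ?xCA //; exact: TrA.
- by exists B; rewrite ?xCA //; exact: TrB.
- by exists A; rewrite ?xCB ?xBA //; exact: TrA.
- by exists C => //; exact: TrC.
Qed.

(** * Four classes of words and their stability under right multiplication by letters *)

Variant rot : Sigma3 -> Prop := Rot i j : rot (R ^+ i * Q ^+ j).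

Variant trpow : Sigma3 -> Prop := TrPow T n of is_tr T : trpow (T ^+ n.+1).

(** Products of transposition letters that together generate ['S_3]. The tail [C C] is absent
    because [xACC] turns it into [B B]. *)
Variant trgen : Sigma3 -> Prop :=
| TrGenB n : trgen (A ^+ n.+1 * B)
| TrGenC n : trgen (A ^+ n.+1 * C)
| TrGenBB n : trgen (A ^+ n.+1 * B * B).

Variant mixed : Sigma3 -> Prop :=
  Mixed n T l of is_tr T : mixed (A ^+ n * T * R ^+ l.+1).

Lemma trgen_mul_tr s T : trgen s -> is_tr T -> trgen (s * T).
Proof.
have tC n : A ^+ n.+1 * B * A = A ^+ n.+2 * C.
  by rewrite -mulgA xBA mulgA -expgSr.
have tB n : A ^+ n.+1 * C * A = A ^+ n.+2 * B.
  by rewrite -mulgA xCA mulgA -expgSr.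
case=> n; case.
- by rewrite tC; constructor.
- by constructor.
- by rewrite -mulgA xBC mulgA -expgSr; constructor.
- by rewrite tB; constructor.
- by rewrite -mulgA xCB mulgA -expgSr; constructor.
- by rewrite expgSr -!(mulgA (A ^+ n)) xACC !mulgA -expgSr; constructor.
- by rewrite -!mulgA [B * _]mulgA xBBA !mulgA -expgSr; constructor.
- have -> : A ^+ n.+1 * B * B * B = A ^+ n.+3 * B.
    by rewrite !expgSr -!(mulgA (A ^+ n)) xABBB !mulgA.
  by constructor.
- by rewrite -!mulgA [B * _]mulgA xBBC !mulgA -!expgSr; constructor.
Qed.

Lemma mixed_mul_R s : mixed s -> mixed (s * R).
Proof. by case=> n T l trT; rewrite -mulgA -expgSr; constructor. Qed.

Lemma mixed_mul_Q s : mixed s -> mixed (s * Q).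
Proof.
case=> n T l /trQ[U trU TQ].
rewrite -mulgA RXQC !mulgA -[_ * Q]mulgA TQ mulgA -[_ * R * _]mulgA -expgS.
by constructor.
Qed.

Lemma mixed_tr2 n T U l : is_tr T -> is_tr U ->
  mixed (A ^+ n * (T * U * R ^+ l.+1)).
Proof.
move=> trT trU; have [V trV TU] := tr2R trT trU.
(* The exponent [l.+1] supplies the [R] that [tr2R] needs, and the [A] it yields joins [A ^+ n]. *)
rewrite expgS [T * U * _]mulgA TU -[A * V * R * _]mulgA -expgS !mulgA -expgSr.
by constructor.
Qed.

Lemma mixed_mul_tr s T : mixed s -> is_tr T -> mixed (s * T).
Proof.
case=> n U l trU /(RXtr l.+1)[V trV RV].
by rewrite -mulgA RV -mulgA [U * _]mulgA; exact: mixed_tr2.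
Qed.

Lemma trgen_mul_R s : trgen s -> mixed (s * R).
Proof.
case=> n; rewrite -[R]expg1; try by constructor; constructor.
by rewrite -!mulgA [B * _]mulgA; apply: mixed_tr2; constructor.
Qed.

Lemma trgen_mul_Q s : trgen s -> mixed (s * Q).
Proof.
case=> n.
- by rewrite -mulgA xBQ mulgA -[R]expg1; do 2 constructor.
- by rewrite -mulgA xCQ mulgA -[R]expg1; do 2 constructor.
- rewrite -!mulgA xBQ [B * _]mulgA -[R]expg1.
  by apply: mixed_tr2; constructor.
Qed.

Lemma tr2_trgen T U : is_tr T -> is_tr U -> T = U \/ trgen (T * U).
Proof.
case; case; try (by left); right; rewrite ?(xBC, xCA, xBA, xCB) -[A]expg1;
  by constructor.
Qed.

Lemma trpow_mul_tr s T : trpow s -> is_tr T -> trpow (s * T) \/ trgen (s * T).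
Proof.
case=> U n trU trT; have [-> | TU] := tr2_trgen trU trT.
  by left; rewrite -expgSr; constructor.
right; elim: n => [|n IHn] //.
(* Moving [T] left past one [U] leaves the shorter product of the induction hypothesis, followed by
   the transposition letter [V]. *)
have [V trV TUV] := tr_swap trU trT.
by rewrite expgSr -mulgA TUV mulgA; exact: trgen_mul_tr.
Qed.

Lemma trpow_mul_R s : trpow s -> mixed (s * R).
Proof.
case=> T n trT; elim: n => [|n IHn].
  by rewrite -[_ * _]mul1g mulgA -[R]expg1; exact: (Mixed 0).
have [U trU TR] := trR trT.
by rewrite expgSr -mulgA TR mulgA; exact: mixed_mul_tr.
Qed.

Lemma trpow_mul_Q s : trpow s -> mixed (s * Q).
Proof.
case=> T [|n] trT; have [U trU TQ] := trQ trT.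
  by rewrite TQ -[_ * _]mul1g mulgA -[R]expg1; exact: (Mixed 0).
have [V trV UR] := trR trU.
rewrite expgSr -mulgA TQ UR mulgA; apply: mixed_mul_tr => //.
by apply: trpow_mul_R; constructor.
Qed.

Lemma rot_mul_R s : rot s -> rot (s * R).
Proof.
case=> i j; rewrite -mulgA (_ : _ * R = R * Q ^+ j) ?mulgA -?expgSr //.
by apply/commute_sym/commuteX/commute_sym/xQR.
Qed.

Lemma rot_mul_Q s : rot s -> rot (s * Q).
Proof. by case=> i j; rewrite -mulgA -expgSr. Qed.

(** Moving [T] to the front turns every [Q] into [R], then changes [T] while passing [R ^+ i]; the
    result is [U * R ^+ (i + j)], free of 3-cycles only if [i + j = 0]. *)
Lemma rot_mul_tr s T : rot s -> is_tr T -> trpow (s * T) \/ mixed (s * T).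
Proof.
case=> i j trT.
have QT : Q ^+ j * T = T * R ^+ j.
  elim: j => [|j IHj]; first by rewrite mul1g mulg1.
  by rewrite expgS -mulgA IHj mulgA Qtr // -mulgA -expgS.
have [U trU RT] := RXtr i trT.
rewrite -mulgA QT mulgA RT -mulgA -expgnDr.
case: (i + j)%N => [|l]; first by left; rewrite mulg1 -[U]expg1; constructor.
by right; rewrite -[U]mul1g; exact: (Mixed 0).
Qed.

Variant normal (s : Sigma3) : Prop :=
| NormalRot of rot s
| NormalTrPow of trpow s
| NormalTrGen of trgen s
| NormalMixed of mixed s.

Lemma normalP s : normal s.
Proof.
rewrite -[s]reprK; elim/last_ind: (repr s) => [|u a IHu].
  constructor 1; have -> : \pi_Sigma3 [::] = R ^+ 0 * Q ^+ 0 by rewrite mulg1.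
  exact: Rot.
rewrite -cats1 -Sigma3_mul_pi -[Sigma3_mul _ _]/(_ * x_ a).
move: (\pi_Sigma3 u) IHu => t.
have tr_case T : is_tr T -> normal t -> normal (t * T).
  move=> trT [] nt.
  - by case: (rot_mul_tr nt trT); [constructor 2 | constructor 4].
  - by case: (trpow_mul_tr nt trT); [constructor 2 | constructor 3].
  - by constructor 3; exact: trgen_mul_tr.
  - by constructor 4; exact: mixed_mul_tr.
elim/S3_ind: a.
- by rewrite x_unit mulg1.
- exact/tr_case/TrA.
- exact/tr_case/TrB.
- exact/tr_case/TrC.
- case=> nt.
  + by constructor 1; exact: rot_mul_R.
  + by constructor 4; exact: trpow_mul_R.
  + by constructor 4; exact: trgen_mul_R.
  + by constructor 4; exact: mixed_mul_R.
- case=> nt.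
  + by constructor 1; exact: rot_mul_Q.
  + by constructor 4; exact: trpow_mul_Q.
  + by constructor 4; exact: trgen_mul_Q.
  + by constructor 4; exact: mixed_mul_Q.
Qed.

(** * Elements of trivial image, rewritten in the six families *)

Lemma alphaM s t : alpha (s * t) = alpha s * alpha t.
Proof. exact: gmulfM. Qed.

Lemma alphaX s n : alpha (s ^+ n) = alpha s ^+ n.
Proof. exact: gmulfXn. Qed.

Lemma c12_sq : c12 ^+ 2 = 1. Proof. perm3. Qed.
Lemma c23_sq : c23 ^+ 2 = 1. Proof. perm3. Qed.
Lemma c13_sq : c13 ^+ 2 = 1. Proof. perm3. Qed.
Lemma c123_cube : c123 ^+ 3 = 1. Proof. perm3. Qed.
Lemma c132_sq : c132 = c123 ^+ 2. Proof. perm3. Qed.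

Lemma c12_neq1 : c12 <> 1. Proof. perm3_neq. Qed.
Lemma c23_neq1 : c23 <> 1. Proof. perm3_neq. Qed.
Lemma c13_neq1 : c13 <> 1. Proof. perm3_neq. Qed.
Lemma c123_neq1 : c123 <> 1. Proof. perm3_neq. Qed.

Lemma expg_eq1_dvdn (gT : finGroupType) (x : gT) p n :
  prime p -> x ^+ p = 1 -> x <> 1 -> x ^+ n = 1 -> p %| n.
Proof.
move=> p_pr xp /eqP x1 xn.
by rewrite -(nt_prime_order p_pr xp x1) order_dvdn xn.
Qed.

Lemma rot_normal_form s : rot s -> alpha s = 1 -> s <> 1 ->
  exists2 e, nf_range e & nf_val e = s.
Proof.
case=> i j.
rewrite alphaM !alphaX !alpha_x [in X in X = 1 -> _]c132_sq -expgnA -expgnDr.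
move=> /(expg_eq1_dvdn (isT : prime 3) c123_cube c123_neq1) dvd_ij s_neq1.
have ij0 : (0 < i + j)%N.
  by case: i j s_neq1 {dvd_ij} => [|i] [|j] //; rewrite mulg1.
(* Divisibility of [i + 2 * j] by 3 means that [i] and [j] agree modulo 3: the common residue counts
   the pairs [R * Q], the quotients count the cubes. *)
exists (NF2 (i %% 3) (i %/ 3) (j %/ 3)) => /=; first by lia.
have eqm : i %% 3 = j %% 3 by lia.
rewrite /s4 /s6 /s7 expgMn; last by rewrite /commute xQR.
rewrite -!expgnA -(mulgA (R ^+ (i %% 3))) (commuteX2 _ _ xQR) !mulgA.
rewrite -expgnDr -mulgA -expgnDr.
by congr (R ^+ _ * Q ^+ _); lia.
Qed.

Lemma trpow_normal_form s : trpow s -> alpha s = 1 ->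
  exists2 e, nf_range e & nf_val e = s.
Proof.
have sq_case (i : 'I_3) (t : 'S_3) n : t ^+ 2 = 1 -> t <> 1 ->
    tnth [tuple s1; s2; s3] i = x_ t ^+ 2 -> alpha (x_ t ^+ n.+1) = 1 ->
    exists2 e, nf_range e & nf_val e = x_ t ^+ n.+1.
  move=> t2 t1 si; rewrite alphaX alpha_x.
  move=> /(expg_eq1_dvdn (isT : prime 2) t2 t1) dvd_n.
  exists (NF1 i (n.+1 %/ 2)) => /=; first by lia.
  by rewrite si -expgnA mulnC divnK.
case=> _ n []; apply: sq_case.
- exact: c12_sq.
- exact: c12_neq1.
- exact: (tnth_nth s1 _ pt1).
- exact: c23_sq.
- exact: c23_neq1.
- exact: (tnth_nth s1 _ pt2).
- exact: c13_sq.
- exact: c13_neq1.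
- exact: (tnth_nth s1 _ pt3).
Qed.

Lemma trgen_normal_form s : trgen s -> alpha s = 1 ->
  exists2 e, nf_range e & nf_val e = s.
Proof.
case=> n; rewrite !alphaM alphaX !alpha_x.
(* A single trailing [B] or [C] gives a transposition or a 3-cycle, never the identity. *)
- rewrite -(expg_mod n.+1 c12_sq) modn2.
  by case: (odd _); rewrite ?expg1 ?expg0; perm3_neq.
- rewrite -(expg_mod n.+1 c12_sq) modn2.
  by case: (odd _); rewrite ?expg1 ?expg0; perm3_neq.
rewrite -mulgA -[c23 * c23]/(c23 ^+ 2) c23_sq mulg1.
move=> /(expg_eq1_dvdn (isT : prime 2) c12_sq c12_neq1) dvd_n.
exists (NF3 (n.+1 %/ 2)) => /=; first by lia.
by rewrite /s1 /s2 -expgnA mulnC divnK // mulgA.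
Qed.

(** This puts [s1 * s4] into [mixed] shape; [xRAB] does the same for [s5]. *)
Lemma xAARQ : A * A * R * Q = A * C * R * R.
Proof.
by rewrite -[A * A * R * Q]mulgA -xQR mulgA -[A * A * Q]mulgA xAQ mulgA.
Qed.

Lemma xRAB : R * A * B = A * B * R.
Proof. by rewrite xRA -mulgA xRB mulgA xCA. Qed.

Lemma mixed_normal_form s : mixed s -> alpha s = 1 ->
  exists2 e, nf_range e & nf_val e = s.
Proof.
case=> n T l trT; rewrite !alphaM !alphaX !alpha_x.
rewrite -(expg_mod n c12_sq) modn2 -(expg_mod l.+1 c123_cube).
have lE := divn_eq l.+1 3; have: (l.+1 %% 3 < 3)%N by rewrite ltn_mod.
have nE := divn_eq n 2; rewrite modn2 in nE.
(* Of the 18 cases three survive: the sign forces [n] to be odd, and then each residue of [l.+1]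
   modulo 3 is compatible with exactly one [T]. *)
case: (odd n) nE => nE; case: (l.+1 %% 3) lE => [|[|[|//]]] lE _; case: trT;
  rewrite ?alpha_x ?expg0 ?expg1 ?mulg1 ?mul1g; try perm3_neq; move=> _.
- exists (NF4 (n %/ 2).+1 (l.+1 %/ 3)) => /=; first by lia.
  rewrite /s1 /s6 -!expgnA -expgSr; by congr (A ^+ _ * R ^+ _); lia.
- exists (NF5 (n %/ 2) (l.+1 %/ 3)) => //=.
  rewrite /s1 /s5 /s6 -!expgnA xRAB !mulgA -expgSr -(mulgA _ R) -expgS.
  by congr (A ^+ _ * B * R ^+ _); lia.
- exists (NF6 (n %/ 2).+1 (l.+1 %/ 3)) => //=.
  rewrite /s1 /s4 /s6 -!expgnA mulnS addnC expgnDr.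
  rewrite -(mulgA (A ^+ _) (A ^+ 2)) [A ^+ 2 * _]mulgA xAARQ !mulgA -expgSr.
  rewrite -(mulgA _ R (R ^+ _)) -expgS -(mulgA _ R (R ^+ _)) -expgS.
  by congr (A ^+ _ * C * R ^+ _); lia.
Qed.

Lemma normal_form_exists s : alpha s = 1 -> s <> 1 ->
  exists2 e, nf_range e & nf_val e = s.
Proof.
move=> a1 s_neq1; case: (normalP s) => [rs | ps | gs | ms].
- exact: rot_normal_form.
- exact: trpow_normal_form.
- exact: trgen_normal_form.
- exact: mixed_normal_form.
Qed.

(** * Invariants of words under the congruence *)

Lemma odd_conjg (T : finType) (a b : {perm T}) :
  odd_perm (b^-1 * a * b) = odd_perm a.
Proof. by rewrite !odd_permM odd_permV addbAC addbb. Qed.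

(** A relation swaps two letters and conjugates one of them, which [P] does not notice; [P 1] must
    fail because the letter of 1 may be erased. *)
Lemma wcong_count (P : pred 'S_3) u v :
  ~~ P 1 -> (forall a b, P (b^-1 * a * b) = P a) ->
  wcong u v -> count P u = count P v.
Proof.
move=> P1 PJ; elim=> {u v} //=.
- by move=> u v w _ -> _ ->.
- by move=> u u' v v' _ uu' _ vv'; rewrite !count_cat uu' vv'.
- by move=> a b; rewrite PJ; lia.
- by move=> a b; have := PJ b a^-1; rewrite invgK => ->; lia.
- by rewrite (negbTE P1).
Qed.

(** The count is taken on a chosen representative, so computing it on products requires an
    invariance hypothesis on [P] or on the letters. *)
Definition cnt (P : pred 'S_3) (s : Sigma3) := count P (repr s).

Definition in_grp (H : {group 'S_3}) (s : Sigma3) := all (mem H) (repr s).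

(** The two letters on either side of a relation generate the same subgroup. *)
Lemma wcong_all (H : {group 'S_3}) u v :
  wcong u v -> all (mem H) u = all (mem H) v.
Proof.
elim=> {u v} //=.
- by move=> u v w _ -> _ ->.
- by move=> u u' v v' _ uu' _ vv'; rewrite !all_cat uu' vv'.
- move=> a b; rewrite !andbT andbC; case bH: (b \in H) => //=.
  by rewrite groupMr // groupMl // groupV.
- move=> a b; rewrite !andbT [RHS]andbC; case aH: (a \in H) => //=.
  by rewrite groupMr ?groupV // groupMl.
- by rewrite group1.
Qed.

(** Conjugation is trivial in an abelian subgroup, so there the relations only permute letters or
    erase the letter of 1. *)
Lemma wcong_count_mem (H : {group 'S_3}) x u v :
  abelian H -> x != 1 -> wcong u v -> all (mem H) u ->
  count_mem x u = count_mem x v.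
Proof.
move=> abH x1 uv; elim: uv => {u v} //=.
- by move=> u v uv IH vH; rewrite IH // (wcong_all _ uv).
- by move=> u v w uv IHu vw IHv uH; rewrite IHu // IHv // -(wcong_all _ uv).
- move=> u u' v v' _ IHu _ IHv; rewrite all_cat => /andP[uH vH].
  by rewrite !count_cat IHu // IHv.
- move=> a b /and3P[aH bH _].
  by rewrite -mulgA ((centsP abH) a aH b bH) mulKg; lia.
- move=> a b /and3P[aH bH _].
  by rewrite ((centsP abH) a aH b bH) mulgK; lia.
- by rewrite eq_sym (negbTE x1).
Qed.

Lemma repr_mul (s t : Sigma3) : wcong (repr (s * t)) (repr s ++ repr t).
Proof. exact: repr_wcong. Qed.

Section LetterCounts.

Variable P : pred 'S_3.
Hypotheses (P1 : ~~ P 1) (PJ : forall a b, P (b^-1 * a * b) = P a).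

Lemma cntM s t : cnt P (s * t) = (cnt P s + cnt P t)%N.
Proof. by rewrite /cnt (wcong_count P1 PJ (repr_mul s t)) count_cat. Qed.

Lemma cnt1 : cnt P 1 = 0.
Proof. by rewrite /cnt (wcong_count P1 PJ (repr_wcong [::])). Qed.

Lemma cntX s n : cnt P (s ^+ n) = (n * cnt P s)%N.
Proof. by elim: n => [|n IHn]; rewrite ?cnt1 // expgS cntM IHn mulSn. Qed.

Lemma cntx a : cnt P (x_ a) = P a.
Proof. by rewrite /cnt (wcong_count P1 PJ (repr_wcong [:: a])) /= addn0. Qed.

End LetterCounts.

Section LettersInGroup.

Variable H : {group 'S_3}.

Lemma in_grpM s t : in_grp H (s * t) = in_grp H s && in_grp H t.
Proof. by rewrite /in_grp (wcong_all H (repr_mul s t)) all_cat. Qed.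

Lemma in_grp1 : in_grp H 1.
Proof. by rewrite /in_grp (wcong_all H (repr_wcong [::])). Qed.

Lemma in_grpX s n : in_grp H (s ^+ n) = (n == 0) || in_grp H s.
Proof.
elim: n => [|n IHn]; first by rewrite in_grp1.
by rewrite expgS in_grpM IHn; case: (in_grp H s); rewrite ?orbT.
Qed.

Lemma in_grpx a : in_grp H (x_ a) = (a \in H).
Proof. by rewrite /in_grp (wcong_all H (repr_wcong [:: a])) /= andbT. Qed.

Variable x : 'S_3.
Hypotheses (abH : abelian H) (x1 : x != 1).

Lemma cnt_memM s t : in_grp H s -> in_grp H t ->
  cnt (pred1 x) (s * t) = (cnt (pred1 x) s + cnt (pred1 x) t)%N.
Proof.
move=> sH tH; rewrite /cnt (wcong_count_mem abH x1 (repr_mul s t)) ?count_cat //.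
by move: (in_grpM s t); rewrite sH tH.
Qed.

Lemma cnt_memX s n : in_grp H s ->
  cnt (pred1 x) (s ^+ n) = (n * cnt (pred1 x) s)%N.
Proof.
move=> sH; elim: n => [|n IHn]; last first.
  by rewrite expgS cnt_memM ?in_grpX ?sH ?orbT // IHn mulSn.
exact: (wcong_count_mem abH x1 (repr_wcong [::]) in_grp1).
Qed.

Lemma cnt_memx a : a \in H -> cnt (pred1 x) (x_ a) = (a == x).
Proof.
rewrite -in_grpx => aH.
by rewrite /cnt (wcong_count_mem abH x1 (repr_wcong [:: a]) aH) /= addn0.
Qed.

End LettersInGroup.

(** In ['S_3] these are the 3-cycles; describing them by sign makes conjugation invariance
    immediate. *)
Definition rotation : pred 'S_3 := fun a => (a != 1) && ~~ odd_perm a.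

Lemma odd_cyc :
  [/\ odd_perm c12, odd_perm c23, odd_perm c13,
      odd_perm c123 = false & odd_perm c132 = false].
Proof.
have oa : odd_perm c12.
  by rewrite (_ : c12 = tperm pt1 pt2) ?odd_tperm //; apply/permP; apply: ord3P;
     rewrite cycE permE.
have ob : odd_perm c23.
  by rewrite (_ : c23 = tperm pt2 pt3) ?odd_tperm //; apply/permP; apply: ord3P;
     rewrite cycE permE.
have oc : odd_perm c13.
  by rewrite (_ : c13 = tperm pt1 pt3) ?odd_tperm //; apply/permP; apply: ord3P;
     rewrite cycE permE.
split=> //.
- by rewrite (_ : c123 = c23 * c12) ?odd_permM ?oa ?ob //; perm3.
- by rewrite (_ : c132 = c12 * c23) ?odd_permM ?oa ?ob //; perm3.
Qed.

(** * Values of the invariants on the six families *)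

Definition nf_odd (e : nf_expr) : nat :=
  match e with
  | NF1 _ n => n * 2
  | NF2 _ _ _ => 0
  | NF3 n => n * 2 + 2
  | NF4 n _ => n * 2
  | NF5 n _ => n * 2 + 2
  | NF6 n _ => n * 2
  end%N.

Definition nf_rot (e : nf_expr) : nat :=
  match e with
  | NF1 _ _ => 0
  | NF2 a m n => a * 2 + m * 3 + n * 3
  | NF3 _ => 0
  | NF4 _ m => m * 3
  | NF5 _ m => m * 3 + 1
  | NF6 _ m => m * 3 + 2
  end%N.

Lemma cnt_odd_nf e : cnt (@odd_perm 'I_3) (nf_val e) = nf_odd e.
Proof.
have P1 : ~~ odd_perm (1 : 'S_3) by rewrite odd_perm1.
have PJ := @odd_conjg 'I_3.
have [oa ob oc or oq] := odd_cyc.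
pose E := (cntM P1 PJ, cntX P1 PJ, cntx P1 PJ, oa, ob, oc, or, oq).
case: e => [i n|a m n|n|n m|n m|n m] /=; last 5 first.
1-5: by rewrite /s1 /s2 /s4 /s5 /s6 /s7 !E; lia.
elim/ord3P: i; rewrite (tnth_nth s1) /= /s1 /s2 /s3 !E; lia.
Qed.

Lemma cnt_rot_nf e : cnt rotation (nf_val e) = nf_rot e.
Proof.
have P1 : ~~ rotation 1 by rewrite /rotation eqxx.
have PJ a b : rotation (b^-1 * a * b) = rotation a.
  by rewrite /rotation odd_conjg -mulgA -conjgE conjg_eq1.
have [oa ob oc or oq] := odd_cyc.
have ra : rotation c12 = false by rewrite /rotation oa andbF.
have rb : rotation c23 = false by rewrite /rotation ob andbF.
have rc : rotation c13 = false by rewrite /rotation oc andbF.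
have rr : rotation c123 by rewrite /rotation or andbT; apply/eqP; perm3_neq.
have rq : rotation c132 by rewrite /rotation oq andbT; apply/eqP; perm3_neq.
pose E := (cntM P1 PJ, cntX P1 PJ, cntx P1 PJ, ra, rb, rc, rr, rq).
case: e => [i n|a m n|n|n m|n m|n m] /=; last 5 first.
1-5: by rewrite /s1 /s2 /s4 /s5 /s6 /s7 !E; lia.
elim/ord3P: i; rewrite (tnth_nth s1) /= /s1 /s2 /s3 !E; lia.
Qed.

(** [nf_rot] sees [m] and [n] only through their sum; counting the letter [R] alone, legitimate
    inside the cyclic group of [c123], separates them. *)
Lemma cnt_mem_nf2 a m n :
  cnt (pred1 c123) (nf_val (NF2 a m n)) = (a + m * 3)%N.
Proof.
have abH : abelian <[c123]> by exact: cycle_abelian.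
have x1 : c123 != 1 by apply/eqP; exact: c123_neq1.
have rH := cycle_id c123.
have qH : c132 \in <[c123]> by rewrite c132_sq mem_cycle.
have neq : (c132 == c123) = false by apply/eqP; perm3_neq.
rewrite /= /s4 /s6 /s7.
pose G := (in_grpM, in_grpX, in_grpx, rH, qH, orbT).
by rewrite !(cnt_memM abH x1, cnt_memX abH x1, cnt_memx abH x1) ?G //
           eqxx neq; lia.
Qed.

(* Only 1 and t commute with a transposition t, so the centralizer of t
   separates the words in the single letter t from all other words. *)
Lemma in_cent_nf1 (i j : 'I_3) n : (0 < n)%N ->
  in_grp 'C[tnth [tuple c12; c23; c13] i]%G (nf_val (NF1 j n)) = (i == j).
Proof.
move=> n_gt0.
have -> : nf_val (NF1 j n) = (x_ (tnth [tuple c12; c23; c13] j) ^+ 2) ^+ n.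
  by congr (_ ^+ n); rewrite !(tnth_nth s1, tnth_nth c12); elim/ord3P: j.
rewrite !in_grpX in_grpx eqn0Ngt n_gt0 /=; apply/cent1P/eqP => [|-> //].
rewrite !(tnth_nth c12) /commute.
by elim/ord3P: i; elim/ord3P: j => //=; perm3_neq.
Qed.

(** Both [c12] and [c23] occur as letters, and no transposition commutes with both. *)
Lemma in_cent_nf3 i n : (0 < n)%N ->
  in_grp 'C[tnth [tuple c12; c23; c13] i]%G (nf_val (NF3 n)) = false.
Proof.
move=> n_gt0; rewrite /= in_grpM !in_grpX !in_grpx eqn0Ngt n_gt0 /=.
apply/negP => /andP[/cent1P + /cent1P]; rewrite !(tnth_nth c12) /commute.
elim/ord3P: i => /=; try by perm3_neq.
by move=> _; perm3_neq.
Qed.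

(** * Uniqueness of the normal form, and the theorem *)

Lemma nf_val_inj e e' : nf_range e -> nf_range e' -> nf_val e = nf_val e' ->
  e = e'.
Proof.
move=> re re' E.
have eO : nf_odd e = nf_odd e' by rewrite -!cnt_odd_nf E.
have eR : nf_rot e = nf_rot e' by rewrite -!cnt_rot_nf E.
(* The two counts rule out every pair of different shapes except [NF1] against [NF3]: only [NF2] has
   no odd letter, and the number of 3-cycles modulo 3 tells [NF4], [NF5] and [NF6] apart. *)
case: e re E eO eR => [i n|a m n|n|n m|n m|n m] re;
  case: e' re' => [i' n'|a' m' n'|n'|n' m'|n' m'|n' m'] re' E;
  cbn [nf_odd nf_rot nf_range] in re, re' |- * => eO eR; try by exfalso; lia.
- have := in_cent_nf1 i i' re'; rewrite -E in_cent_nf1 // eqxx => /esym/eqP <-.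
  by congr NF1; lia.
- by have := in_cent_nf3 i re'; rewrite -E in_cent_nf1 // eqxx.
- have := cnt_mem_nf2 a m n; rewrite E cnt_mem_nf2 => eA.
  by congr NF2; lia.
- by have := in_cent_nf3 i' re; rewrite E in_cent_nf1 // eqxx.
- by congr NF3; lia.
- by congr NF4; lia.
- by congr NF5; lia.
- by congr NF6; lia.
Qed.

Theorem theorem2p5 :
  [/\ s1 \in Sigma31, s2 \in Sigma31, s3 \in Sigma31 & s4 \in Sigma31] /\
  [/\ s5 \in Sigma31, s6 \in Sigma31 & s7 \in Sigma31] /\
  (forall s : Sigma3, s \in Sigma31 -> s <> 1 ->
     exists! e : nf_expr, nf_range e /\ nf_val e = s).
Proof.
split; last split.
- by split; rewrite inE ?(alphaX, alphaM) !alpha_x; apply/eqP; perm3.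
- by split; rewrite inE ?(alphaX, alphaM) !alpha_x; apply/eqP; perm3.
move=> s /eqP alpha_s s_neq1.
have [e re es] := normal_form_exists alpha_s s_neq1.
by exists e; split=> // e' [re' e's]; apply: nf_val_inj; rewrite // es e's.
Qed.
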